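(* Let $Q$ be a countable field of finite (i.e. positive) characteristic which is an algebraic extension of its prime field, let $n\in\mathbb{N}$ and let $G=\mathrm{GL}_n(Q)$. Then $G$ is amenable, and there is a two-sided Følner sequence $F=(F_N)_{N\in\mathbb{N}}$ in $G$ such that, for all measure preserving systems $(X,\mathcal{B},\mu,(T_g)_{g\in G})$ and all $Y\in\mathcal{B}$, we have $$\limsup_{N\to\infty}\frac{1}{|F_N|}\sum_{g\in F_N}\mu(Y\cap T_g^2Y)\geq\frac{\mu(Y)^2}{n!}.$$ Thus, for all $A\subseteq G$ there is $B\subseteq G$ such that $\overline{d}_F(B)\geq \frac{d^*_l(A)^2}{n!}$ and $BB\subseteq AA^{-1}$.
   Context: ''Countable'' means in bijective correspondence with $\mathbb{N}$. A left Følner sequence in a countable group $G$ is a sequence $(F_N)_{N\in\mathbb{N}}$ of finite nonempty subsets of $G$ such that $\lim_{N\to\infty}\frac{|gF_N\Delta F_N|}{|F_N|}=0$ for all $g\in G$; it is a right Følner sequence if $\lim_{N\to\infty}\frac{|F_Ng\Delta F_N|}{|F_N|}=0$ for all $g\in G$; it is two-sided if it is both left and right Følner. $G$ is amenable if it has a left Følner sequence. A measure preserving system $(X,\mathcal{B},\mu,(T_g)_{g\in G})$ consists of a probability space $(X,\mathcal{B},\mu)$ and a left action of $G$ on $X$ by measure-preserving maps $T_g$, so that $T_{gh}=T_g\circ T_h$. For $E\subseteq G$, $\overline{d}_F(E)=\limsup_{N\to\infty}\frac{|E\cap F_N|}{|F_N|}$, and $d^*_l(E)=\sup\{\overline{d}_{F'}(E):F'\text{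 a left Følner sequence in }G\}$. $BB=\{bb':b,b'\in B\}$ and $AA^{-1}=\{aa'^{-1}:a,a'\in A\}$. *)

(* Defs.v *)
From HB Require Import structures.
From mathcomp Require Import all_boot all_order all_algebra finfield.
From mathcomp Require Import finmap.
From mathcomp Require Import all_classical all_reals all_analysis.

Set Implicit Arguments.
Unset Strict Implicit.
Unset Printing Implicit Defensive.

Import Order.TTheory GRing.Theory Num.Theory.
Import numFieldNormedType.Exports.

Local Open Scope classical_set_scope.
Local Open Scope ring_scope.

(* MathComp's {'GL_n[Q]} requires Q to be finite, hence this definition.      *)
Section GeneralLinearGroup.
Variables (Q : fieldType) (n : nat).

Record GL := MkGL { GLmx :> 'M[Q]_n; GLmx_unit : GLmx \in unitmx }.

HB.instance Definition _ := [isSub for GLmx].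
HB.instance Definition _ := [Choice of GL by <:].

Lemma GL_mul_subproof (A B : GL) : A *m B \in unitmx.
Proof. by rewrite unitmx_mul !GLmx_unit. Qed.

Lemma GL_inv_subproof (A : GL) : invmx A \in unitmx.
Proof. by rewrite unitmx_inv GLmx_unit. Qed.

Definition GL_one : GL := MkGL (unitmx1 Q n).
Definition GL_mul (A B : GL) : GL := MkGL (GL_mul_subproof A B).
Definition GL_inv (A : GL) : GL := MkGL (GL_inv_subproof A).

Lemma GL_mulA : associative GL_mul.
Proof. by move=> A B C; apply: val_inj; rewrite /= mulmxA. Qed.

Lemma GL_mul1 : left_id GL_one GL_mul.
Proof. by move=> A; apply: val_inj; rewrite /= mul1mx. Qed.

Lemma GL_mulr1 : right_id GL_one GL_mul.
Proof. by move=> A; apply: val_inj; rewrite /= mulmx1. Qed.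

Lemma GL_mulV : left_inverse GL_one GL_inv GL_mul.
Proof. by move=> A; apply: val_inj; rewrite /= mulVmx ?GLmx_unit. Qed.

Lemma GL_mulrV : right_inverse GL_one GL_inv GL_mul.
Proof. by move=> A; apply: val_inj; rewrite /= mulmxV ?GLmx_unit. Qed.

HB.instance Definition _ :=
  isGroup.Build GL GL_mulA GL_mul1 GL_mulr1 GL_mulV GL_mulrV.

End GeneralLinearGroup.

Section Folner.
Variables (R : realType) (G : groupType).
Implicit Types (F : nat -> {fset G}) (E : set G).

Definition fset_symdiff (A B : {fset G}) : {fset G} :=
  ((A `\` B) `|` (B `\` A))%fset.

Definition left_translate (g : G) (A : {fset G}) : {fset G} :=
  [fset (g * x)%g | x in A]%fset.

Definition right_translate (A : {fset G}) (g : G) : {fset G} :=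
  [fset (x * g)%g | x in A]%fset.

Definition left_Folner F : Prop :=
  (forall N, F N != fset0) /\
  forall g : G,
    (#|` fset_symdiff (left_translate g (F N)) (F N)|%:R / #|` F N|%:R : R)
      @[N --> \oo] --> (0 : R).

Definition right_Folner F : Prop :=
  (forall N, F N != fset0) /\
  forall g : G,
    (#|` fset_symdiff (right_translate (F N) g) (F N)|%:R / #|` F N|%:R : R)
      @[N --> \oo] --> (0 : R).

Definition two_sided_Folner F : Prop := left_Folner F /\ right_Folner F.

Definition amenable : Prop := exists F, left_Folner F.

Definition upper_density F E : \bar R :=
  limn_esup (fun N =>
    (#|` [fset x in F N | x \in E]%fset|%:R / #|` F N|%:R)%:E).

Definition upper_left_Banach_density E : \bar R :=
  ereal_sup [set upper_density F E | F in left_Folner].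

End Folner.

Arguments amenable : clear implicits.

Section MeasurePreservingSystem.
Variables (R : realType) (G : groupType).
Variables (d : measure_display) (X : measurableType d) (mu : probability X R).

Definition measure_preserving (f : X -> X) : Prop :=
  measurable_fun [set: X] f /\
  forall A, measurable A -> mu (f @^-1` A) = mu A.

Definition measure_preserving_system (T : G -> X -> X) : Prop :=
  [/\ T 1%g = id,
      forall g h : G, T (g * h)%g = T g \o T h
    & forall g : G, measure_preserving (T g)].

End MeasurePreservingSystem.

(* Main.v *)
Require Import Defs.
From HB Require Import structures.
From mathcomp Require Import all_boot all_order all_algebra finfield.
From mathcomp Require Import finmap.
From mathcomp Require Import all_classical all_reals all_analysis.
From mathcomp Require Import perm measurable_realfun.
From mathcomp Require Import lra ring.

Set Implicit Arguments.
Unset Strict Implicit.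
Unset Printing Implicit Defensive.

Import Order.TTheory GRing.Theory Num.Theory.
Import numFieldNormedType.Exports.

Local Open Scope classical_set_scope.
Local Open Scope ring_scope.

(** The group G = GL_n(Q) is locally finite.  Every x in Q is fixed by a power
of the Frobenius map, so the finite fields K_k = {x | x ^ (p ^ k!) = x}
increase to Q and the finite groups H_k = GL_n(K_k) increase to G.  Any g in G
lies in H_k for all large k, and then g H_k = H_k = H_k g.  Hence (H_k) is a
two-sided Folner sequence; it serves as F.

Recurrence along squares.  Let phi(g) = mu(Y :&: T_g Y).  If D is a finite
abelian group, squaring is an endomorphism of D, and Cauchy-Schwarz shows that
the average of phi(t ^ 2) over D is at least mu(Y) ^ 2 (sum_squares_conj).
This is applied to the conjugates in H_k of the group D of diagonal matrices.
A matrix with n distinct eigenvalues in K_k can be written as h t h^-1, with t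
diagonal, in at most n! * #|D| ways, because two choices of h differ by a
monomial matrix (regular_diag_conj_monomial, sum_conjugates_le); and the
diagonal matrices with a repeated eigenvalue are a fraction of at most
n ^ 2 / (q - 1) of D, where q = #|K_k| (sum_torus_irregular_le).  As phi is
nonnegative, the average of phi(g ^ 2) over g in H_k is therefore at least
(mu(Y) ^ 2 - n ^ 2 / (q - 1)) / n! (sum_squares_GLfset), and q tends to
infinity.  All that matters about phi is that it takes values in [0, 1] and is
positive definite with a known mean, which is the property mean_positive.

The set B.  Let delta be the left Banach density of A.  Averaging over a Folner
set shows that each H_M has a coset H_M y in which A has density at least delta
(upper_left_Banach_density_le_coset).  For x in G put
B_x = {b | b x and b^-1 x are in A}.  Then B_x B_x is contained in A A^-1, since
b b' = (b x) (b'^-1 x)^-1.  For k <= M the average over x in H_M y of the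
density of B_x in H_k is the average over the b in H_k of the density in H_M y
of {x | x and b ^ 2 x are in A} (average_return_density).  The latter is a
positive definite function of b ^ 2, so the average is at least
delta ^ 2 / n! - o(1).

It remains to find a single set whose density in H_k is nearly that large for
infinitely many k, which is what the reverse Fatou lemma would give on a limit
probability space.  Instead of building that space, finitary_Fatou works with
the averages over the cosets H_M y and an ultrafilter on M: it gives points x_i
such that, for all j <= i, B_(x_i) has density at least
delta ^ 2 / n! - 1 / (j + 1) in some H_k with k in a window [j, K_j) that does
not depend on i.  The ultralimit A' of the sets A x_i^-1 then agrees with one of
them on any given finite set, so B = A' :&: A'^-1 has the required upper
density, and B B is still contained in A A^-1. *)

(** * Bounds for upper limits *)

Section Limsup.
Variable R : realType.

Lemma le_limn_esup (u : nat -> \bar R) (c : R) :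
  (forall e : R, 0 < e -> forall m, exists2 k, (m <= k)%N & ((c - e)%:E <= u k)%E) ->
  (c%:E <= limn_esup u)%E.
Proof.
move=> uP; rewrite /limn_esup limf_esupE; apply: le_ereal_inf_tmp => _ [V [m _ mV] <-].
apply/lee_addgt0Pr => e e0.
have [k mk uk] := uP e e0 m.
rewrite -leeBlDr//; apply: le_trans (ereal_sup_ubound _); first exact: uk.
by exists k => //; apply: mV.
Qed.

Lemma limn_esup_le (u : nat -> \bar R) (c : R) :
  (forall e : R, 0 < e -> \forall k \near \oo, (u k <= (c + e)%:E)%E) ->
  (limn_esup u <= c%:E)%E.
Proof.
move=> uP; apply/lee_addgt0Pr => e e0; rewrite /limn_esup limf_esupE.
apply: (@le_trans _ _ (ereal_sup (u @` [set k | (u k <= (c + e)%:E)%E]))).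
  by apply: ereal_inf_lbound; exists [set k | (u k <= (c + e)%:E)%E] => //; exact: uP.
by apply: ge_ereal_sup => _ [k /= uk <-].
Qed.
End Limsup.

(** * Finite subfields of an algebraic extension of a prime field *)

(** A finite subring of a field is a subfield. *)
Definition fset_subring (Q : fieldType) (K : {fset Q}) : Prop :=
  [/\ 1 \in K, {in K &, forall x y, x - y \in K} &
      {in K &, forall x y, x * y \in K}].

Lemma finite_roots (Q : fieldType) (r : {poly Q}) :
  r != 0 -> finite_set [set x | root r x].
Proof.
move=> r0; apply: contrapT => /(infinite_set_fset (size r))[B Br].
rewrite leqNgt => /negP; apply; apply: max_poly_roots => //.
  by apply/allP => x /Br.
exact: fset_uniq.
Qed.

Section FiniteSubfields.
Variables (Q : fieldType) (p : nat) (charQ : p \in [pchar Q]).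

Local Notation phi := (pFrobenius_aut charQ).
Local Notation iota := (GRing.in_alg (pPrimeCharType charQ)).

Lemma iter_Frobenius k (x : Q) : iter k phi x = x ^+ (p ^ k).
Proof.
elim: k => [|k IH]; first by rewrite expn0 expr1.
by rewrite iterS IH pFrobenius_autE -exprM expnSr.
Qed.

Lemma Frobenius_inj : injective phi.
Proof. exact: fmorph_inj. Qed.

Lemma iter_Frobenius_mul (x : Q) d e :
  x ^+ (p ^ d) = x -> x ^+ (p ^ (d * e)) = x.
Proof.
move=> xd; elim: e => [|e IH]; first by rewrite muln0 expn0 expr1.
by rewrite mulnS expnD exprM xd IH.
Qed.

Lemma Frobenius_prime_field (c : 'F_p) : phi (iota c) = iota c.
Proof.
rewrite pFrobenius_autE; have pp := pcharf_prime charQ.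
transitivity (iota (c ^+ p)); first by rewrite [RHS]rmorphXn.
by rewrite -[X in c ^+ X](card_Fp pp) expf_card.
Qed.

(** The iterates of x under Frobenius are all roots of an annihilating
polynomial of x, because its coefficients are fixed by Frobenius.  So two of
them coincide, and injectivity of Frobenius takes this back to x itself. *)
Lemma algebraic_Frobenius_periodic (x : Q) :
  algebraicOver iota x -> exists2 d, (0 < d)%N & x ^+ (p ^ d) = x.
Proof.
case=> q q0 qx; pose r : {poly Q} := map_poly iota q.
have phir : map_poly phi r = r.
  rewrite -map_poly_comp; apply: eq_map_poly => c.
  exact: Frobenius_prime_field.
have ri i : root r (iter i phi x).
  by elim: i => [|i IH]; [exact: qx | rewrite iterS -phir fmorph_root].
have r0 : map_poly iota q != 0 by rewrite map_poly_eq0.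
have [u|] := boolP (uniq [seq iter i phi x | i <- seq.iota 0 (size r)]).
  have /(max_poly_roots r0)/(_ u) :
      all (root r) [seq iter i phi x | i <- seq.iota 0 (size r)].
    by apply/allP => _ /mapP[i _ ->].
  by rewrite size_map size_iota ltnn.
move=> /(uniqPn x)[i [j [ij]]]; rewrite size_map size_iota => jr.
have ir := ltn_trans ij jr.
rewrite !(nth_map 0%N) ?size_iota// !nth_iota// !add0n => eij.
exists (j - i)%N; first by rewrite subn_gt0.
have iter_inj m : injective (iter m phi).
  by elim: m => // m IH y z /Frobenius_inj /IH.
rewrite -iter_Frobenius; apply: (iter_inj i).
by rewrite -iterD subnKC ?(ltnW ij).
Qed.

(** The factorial in the exponent makes these subfields increase with k, each
positive d being a divisor of all large factorials. *)
Definition Frobenius_fixed (k : nat) : {fset Q} :=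
  fset_set [set x : Q | x ^+ (p ^ k`!) == x].

Lemma in_Frobenius_fixed k x : (x \in Frobenius_fixed k) = (x ^+ (p ^ k`!) == x).
Proof.
have p1 : (1 < p)%N by exact/prime_gt1/(pcharf_prime charQ).
have pk1 : (1 < p ^ k`!)%N by rewrite -(expn0 p) ltn_exp2l// fact_gt0.
rewrite in_fset_set; first by apply/idP/idP; rewrite inE.
pose r : {poly Q} := 'X^(p ^ k`!) - 'X.
have szr : size r = (p ^ k`!).+1.
  by rewrite size_polyDl ?size_polyXn// size_polyN size_polyX ltnS.
have r0 : r != 0 by rewrite -size_poly_eq0 szr.
apply: (sub_finite_set _ (finite_roots r0)) => y /=.
by rewrite rootE !hornerE subr_eq0.
Qed.

Lemma Frobenius_fixed_subring k : fset_subring (Frobenius_fixed k).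
Proof.
split=> [|x y|x y]; rewrite !in_Frobenius_fixed ?expr1n//.
  move=> /eqP xk /eqP yk; rewrite -iter_Frobenius.
  have -> : iter k`! phi (x - y) = iter k`! phi x - iter k`! phi y.
    by elim: (k`!) => // m IH; rewrite !iterS IH rmorphB.
  by rewrite !iter_Frobenius xk yk.
by move=> /eqP xk /eqP yk; rewrite exprMn xk yk.
Qed.

Lemma Frobenius_fixed_mono k l : (k <= l)%N ->
  {subset Frobenius_fixed k <= Frobenius_fixed l}.
Proof.
move=> kl x; rewrite !in_Frobenius_fixed => /eqP xk; apply/eqP.
by rewrite -(bin_fact kl) mulnC -mulnA iter_Frobenius_mul.
Qed.

Lemma Frobenius_fixed_exhaust (x : Q) : algebraicOver iota x ->
  exists k, x \in Frobenius_fixed k.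
Proof.
move=> /algebraic_Frobenius_periodic[[//|d] _ xd]; exists d.+1.
by rewrite in_Frobenius_fixed factS iter_Frobenius_mul.
Qed.

Hypothesis Q_algebraic : forall x : Q, algebraicOver iota x.

Lemma Frobenius_fixed_absorb (B : {fset Q}) :
  exists k, forall l, (k <= l)%N -> {subset B <= Frobenius_fixed l}.
Proof.
have /choice[f fP] : forall x : Q, exists k, x \in Frobenius_fixed k.
  by move=> x; exact: Frobenius_fixed_exhaust.
exists (\max_(x <- B) f x)%N => l kl x xB.
by apply: Frobenius_fixed_mono (fP x); apply: leq_trans kl; exact: leq_bigmax_seq.
Qed.

Lemma card_Frobenius_fixed : infinite_set [set: Q] ->
  forall m, exists k, forall l, (k <= l)%N -> (m <= #|` Frobenius_fixed l|)%N.
Proof.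
move=> Qinf m; have [B _ mB] := infinite_set_fset m Qinf.
have [k kP] := Frobenius_fixed_absorb B; exists k => l kl.
by apply: leq_trans mB _; apply/fsubset_leq_card/fsubsetP; exact: kP.
Qed.

End FiniteSubfields.

(** * Finite subgroups, and matrices over a finite subfield *)

Section FiniteSubgroups.
Variable G : groupType.
Implicit Types (H : {fset G}) (g h : G).

Definition fset_subgroup H : Prop :=
  [/\ (1 \in H)%g, {in H &, forall g h, (g * h)%g \in H} &
      {in H, forall g, g^-1%g \in H}].

Lemma imfset_endo (T : choiceType) (A : {fset T}) (f : T -> T) :
  {in A, forall x, f x \in A} -> {in A &, injective f} -> [fset f x | x in A]%fset = A.
Proof.
move=> fA fI; apply/eqP; rewrite eqEfcard card_in_imfset// leqnn andbT.
by apply/fsubsetP => _ /imfsetP[x xA ->]; exact: fA.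
Qed.

Lemma sum_endo (T : choiceType) (V : nmodType) (A : {fset T}) (f : T -> T) (F : T -> V) :
  {in A, forall x, f x \in A} -> {in A &, injective f} ->
  \sum_(x <- A) F (f x) = \sum_(x <- A) F x.
Proof.
move=> fA fI; rewrite -[in RHS](imfset_endo fA fI).
by rewrite [RHS]big_imfset.
Qed.

(** Left multiplication by g is an injection of H into itself, hence it
reaches 1. *)
Lemma fset_submonoid_subgroup H :
  (1 \in H)%g -> {in H &, forall g h, (g * h)%g \in H} -> fset_subgroup H.
Proof.
move=> H1 HM; split=> // g gH.
have : (1%g \in [fset (g * h)%g | h in H]%fset).
  rewrite imfset_endo// => [h hH|h k _ _ /mulgI//]; exact: HM.
by move=> /imfsetP[/= h hH e]; rewrite -(mulg1 g^-1%g) e mulKg.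
Qed.

Section Translations.
Variables (H : {fset G}) (Hgrp : fset_subgroup H).

Lemma sum_mulgl (V : nmodType) g (F : G -> V) : g \in H ->
  \sum_(h <- H) F (g * h)%g = \sum_(h <- H) F h.
Proof.
case: Hgrp => _ HM _ gH; apply: sum_endo => [h hH|h k _ _ /mulgI//].
exact: HM.
Qed.

End Translations.
End FiniteSubgroups.

Section GLfset.
Variables (Q : fieldType) (n : nat).
Implicit Types (K : {fset Q}) (g h : GL Q n).

(** Matrices with entries in K that are invertible over Q; when K is a subring,
this is GL_n(K), the inverse having entries in K by finiteness
(GLfset_subgroup). *)
Definition GLfset K : {fset GL Q n} :=
  fset_set [set g : GL Q n | forall i j, GLmx g i j \in K].

Lemma in_GLfset K g : g \in GLfset K <-> forall i j, GLmx g i j \in K.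
Proof.
rewrite in_fset_set; first by rewrite inE.
pose f (v : {ffun 'I_n * 'I_n -> K}) : GL Q n :=
  insubd (GL_one Q n) (\matrix_(i, j) fsval (v (i, j))).
apply: (@sub_finite_set _ _ (f @` setT)); last exact: finite_image.
move=> h /= hK; exists [ffun ij => FSetSub (hK ij.1 ij.2)] => //.
apply: val_inj; rewrite /f insubdK /=.
  by apply/matrixP => i j; rewrite mxE ffunE.
set A := (X in X \in _); suff -> : A = GLmx h by exact: GLmx_unit.
by apply/matrixP => i j; rewrite mxE ffunE.
Qed.

Section Subring.
Variables (K : {fset Q}) (Kring : fset_subring K).

Lemma fset_subring0 : 0 \in K.
Proof. by case: Kring => K1 KB _; rewrite -(subrr 1) KB. Qed.

Lemma fset_subring_sum (I : Type) (r : seq I) (F : I -> Q) :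
  (forall i, F i \in K) -> \sum_(i <- r) F i \in K.
Proof.
move=> FK; apply: (big_ind (fun x => x \in K)) => // [|x y xK yK].
  exact: fset_subring0.
case: Kring => K1 KB _; rewrite -[y]opprK KB//.
by rewrite -sub0r KB// fset_subring0.
Qed.

Lemma GLfset_subgroup : fset_subgroup (GLfset K).
Proof.
case: (Kring) => K1 _ KM.
apply: fset_submonoid_subgroup.
  apply/in_GLfset => i j; rewrite mxE.
  by case: eqP; rewrite ?K1// fset_subring0.
move=> g h /in_GLfset gK /in_GLfset hK; apply/in_GLfset => i j.
by rewrite mxE fset_subring_sum// => k; exact: KM.
Qed.

End Subring.
End GLfset.

(** * Sums over the conjugates of an abelian subgroup *)

Section ConjugatesOfAbelianSubgroup.
Variables (R : realFieldType) (G : groupType).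
Implicit Types (H D : {fset G}) (phi F : G -> R).

(** For phi(g) = <f, g f> in a unitary representation, the right-hand side is
the square norm of the sum of the a f for a in s, which is at least
(size s) ^ 2 times the square norm m of the projection of f to the constants, or
to any other space of invariant vectors.  Both return measures and coset correlations have this property. *)
Definition mean_positive H phi (m : R) : Prop :=
  forall s : seq G, {subset s <= H} ->
    (size s)%:R ^+ 2 * m <= \sum_(a <- s) \sum_(b <- s) phi (a^-1 * b)%g.

Lemma ler_sum_fset (T : choiceType) (A : {fset T}) (F1 F2 : T -> R) :
  {in A, forall x, F1 x <= F2 x} -> \sum_(x <- A) F1 x <= \sum_(x <- A) F2 x.
Proof.
by move=> F12; rewrite big_seq [leRHS]big_seq; apply: ler_sum => x /F12.
Qed.

Lemma sum_indicator (T : choiceType) (A : {fset T}) (P : pred T) (F : T -> R) :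
  \sum_(x <- A | P x) F x = \sum_(x <- A) (P x)%:R * F x.
Proof.
by rewrite big_mkcond; apply: eq_bigr => x _; case: (P x); rewrite ?mul1r ?mul0r.
Qed.

Lemma sum_subfset (T : choiceType) (A B : {fset T}) (F : T -> R) : (B `<=` A)%fset ->
  \sum_(x <- B) F x = \sum_(x <- A) (x \in B)%:R * F x.
Proof.
move=> BA; rewrite -sum_indicator [RHS]big_fset_condE; apply: eq_fbigl => x.
rewrite !inE /=; case xB : (x \in B); rewrite ?andbF// andbT.
by rewrite (fsubsetP BA).
Qed.

Lemma card_fset_sumR (T : choiceType) (A : {fset T}) :
  \sum_(x <- A) 1 = #|` A|%:R :> R.
Proof. by rewrite card_fset_sum1 natr_sum. Qed.

(** The elements a = (h t h^-1) ^ 2, for t in D, satisfy the identity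
a(s)^-1 a(t) = a(s^-1 t) because D is abelian, so that the double sum in
mean_positive is #|D| times the sum of phi over the a(t). *)
Lemma sum_squares_conj H D phi m h : fset_subgroup H -> fset_subgroup D ->
  {subset D <= H} -> {in D &, forall s t, s * t = t * s}%g -> h \in H ->
  mean_positive H phi m ->
  #|` D|%:R * m <= \sum_(t <- D) phi ((h * t * h^-1) * (h * t * h^-1))%g.
Proof.
move=> [H1 HM HV] Dgrp DH Dab hH phim; have [D1 DM DV] := Dgrp.
pose F t := phi ((h * t * h^-1) * (h * t * h^-1))%g.
have D0 : 0 < #|` D|%:R :> R by rewrite ltr0n cardfs_gt0; apply/fset0Pn; exists 1%g.
rewrite -(ler_pM2l D0) mulrA -expr2.
have := phim [seq ((h * t * h^-1) * (h * t * h^-1))%g | t <- D] _.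
rewrite size_map !big_map => /(_ _)/le_trans; apply.
  by move=> _ /mapP[t /DH tH ->]; rewrite !(HM, HV).
rewrite le_eqVlt; apply/orP; left; apply/eqP.
transitivity (\sum_(s <- D) \sum_(t <- D) F t); last first.
  by rewrite big_const_seq count_predT iter_addr_0 mulr_natl.
apply: eq_big_seq => s sD; rewrite big_map -(sum_mulgl Dgrp F (DV s sD)).
apply: eq_big_seq => t tD; congr phi.
rewrite !invgM !invgK -!mulgA; congr (h * _)%g.
rewrite !mulKg; congr (s^-1 * _)%g.
by rewrite [RHS]mulgA (Dab t s^-1%g tD (DV s sD)) -mulgA.
Qed.

(** Each g in H is counted on the left once for each h with h^-1 g h regular in
D.  If h0 is one such h, the hypothesis on w puts every other one in some coset
h0 w(i)^-1 D, so that there are at most #|I| #|D| of them.  For the torus of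
GL_n, the w(i) represent the Weyl group. *)
Lemma sum_conjugates_le (I : finType) (w : I -> G) H D (reg : pred G) F :
  fset_subgroup H -> {subset D <= H} -> (forall i, w i \in H) ->
  (forall h s t, h \in H -> s \in D -> t \in D -> reg s -> reg t ->
     (h * s = t * h)%g -> exists i, (w i * h)%g \in D) ->
  {in H, forall g, 0 <= F g} ->
  \sum_(h <- H) \sum_(t <- D | reg t) F (h * t * h^-1)%g <=
  (#|I| * #|` D|)%:R * \sum_(g <- H) F g.
Proof.
move=> Hgrp DH wH wP F0; have [H1 HM HV] := Hgrp.
pose DR := [fset t in D | reg t]%fset.
have DRP t : (t \in DR) = (t \in D) && reg t by rewrite !inE.
have DRH : (DR `<=` H)%fset by apply/fsubsetP => t; rewrite DRP => /andP[/DH].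
have -> : \sum_(h <- H) \sum_(t <- D | reg t) F (h * t * h^-1)%g =
    \sum_(g <- H) F g * \sum_(h <- H) (h^-1 * g * h \in DR)%g%:R.
  under [RHS]eq_bigr do rewrite mulr_sumr.
  rewrite [RHS]exchange_big/=; apply: eq_big_seq => h hH.
  rewrite big_fset_condE/= (sum_subfset _ DRH).
  have -> : \sum_(g <- H) F g * (h^-1 * g * h \in DR)%g%:R =
     \sum_(t <- H) F (h * t * h^-1)%g * (h^-1 * (h * t * h^-1) * h \in DR)%g%:R.
    apply/esym/(@sum_endo _ _ H (fun t => h * t * h^-1)%g
      (fun g => F g * (h^-1 * g * h \in DR)%g%:R)).
      by move=> t tH; rewrite !(HM, HV).
    by move=> s t _ _ /mulIg /mulgI.
  by apply: eq_bigr => t _; rewrite mulrC -!mulgA mulKg mulVg mulg1.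
rewrite mulr_sumr; apply: ler_sum_fset => g gH; rewrite mulrC ler_wpM2r ?F0//.
have [/hasP[h0 h0H /= g0]|/hasPn none] := boolP (has (fun h => h^-1 * g * h \in DR)%g H).
  apply: (@le_trans _ _ (\sum_(h <- H) \sum_(i : I) (w i * (h0^-1 * h) \in D)%g%:R)).
    apply: ler_sum_fset => h hH; have [hg|_] := boolP (h^-1 * g * h \in DR)%g; last first.
      exact: sumr_ge0.
    move: hg g0; rewrite !DRP => /andP[sD sr] /andP[tD tr].
    have [||i wi] := wP (h0^-1 * h)%g _ _ _ sD tD sr tr.
    - by rewrite !(HM, HV).
    - by rewrite -!mulgA !mulVKg.
    by rewrite (bigD1 i)//= wi lerDl sumr_ge0.
  have -> : (#|I| * #|` D|)%:R = \sum_(i : I) #|` D|%:R :> R.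
    by rewrite sumr_const natrM mulr_natl.
  rewrite exchange_big/=; apply: ler_sum => i _.
  have wh0 : (w i * h0^-1)%g \in H by rewrite HM ?HV.
  under eq_bigr do rewrite mulgA.
  rewrite (sum_mulgl Hgrp (fun h => (h \in D)%:R) wh0) -card_fset_sumR.
  have DHs : (D `<=` H)%fset by apply/fsubsetP.
  rewrite (sum_subfset _ DHs).
  by under [leRHS]eq_bigr do rewrite mulr1.
rewrite big_seq big1 ?ler0n// => h /none /negbTE ->//.
Qed.

End ConjugatesOfAbelianSubgroup.

(** * The split torus of the general linear group over a finite field *)

Section SplitTorus.
Variables (Q : fieldType) (n : nat).
Implicit Types (K : {fset Q}) (g h s t : GL Q n).

Lemma mulmx_diagl (A B : 'M[Q]_n) i j : is_diag_mx A -> (A *m B) i j = A i i * B i j.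
Proof.
move=> /is_diag_mxP Adiag; rewrite mxE (bigD1 i)//= big1 ?addr0// => k ki.
by rewrite Adiag ?mul0r// eq_sym.
Qed.

Lemma mulmx_diagr (A B : 'M[Q]_n) i j : is_diag_mx A -> (B *m A) i j = B i j * A j j.
Proof.
move=> /is_diag_mxP Adiag; rewrite mxE (bigD1 j)//= big1 ?addr0// => k kj.
by rewrite Adiag ?mulr0.
Qed.

Lemma GLmxM g h : GLmx (g * h)%g = GLmx g *m GLmx h.
Proof. by []. Qed.

Definition diag_regular g : bool :=
  [forall i, forall j, (GLmx g i i == GLmx g j j) ==> (i == j)].

Lemma diag_regularP g :
  reflect (injective (fun i => GLmx g i i)) (diag_regular g).
Proof.
apply: (iffP forallP) => [gr i j /eqP gij|gi i].
  by have /forallP/(_ j)/implyP/(_ gij)/eqP := gr i.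
by apply/forallP => j; apply/implyP => /eqP /gi ->.
Qed.

Definition perm_GL (s : {perm 'I_n}) : GL Q n := MkGL (unitmx_perm Q s).

Lemma GL_col_neq0 g j : exists i, GLmx g i j != 0.
Proof.
apply: contrapT => /forallNP g0.
have /eqP := congr1 (fun A : 'M[Q]_n => A j j) (mulVmx (GLmx_unit g)).
rewrite !mxE eqxx big1 ?(eq_sym 0) ?oner_eq0// => k _.
by have /negP/negPn/eqP -> := g0 k; rewrite mulr0.
Qed.

(** The equation h s = t h says that h i j vanishes unless s and t have the same
j-th and i-th eigenvalue.  As these are distinct within s and within t, each
column of h has a single nonzero entry, and these entries lie in different
rows. *)
Lemma regular_diag_conj_monomial h s t :
  is_diag_mx (GLmx s) -> is_diag_mx (GLmx t) -> diag_regular s -> diag_regular t ->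
  (h * s = t * h)%g -> exists w, is_diag_mx (GLmx (perm_GL w * h)%g).
Proof.
move=> sD tD /diag_regularP sr /diag_regularP tr hst.
have E i j : GLmx h i j != 0 -> GLmx s j j = GLmx t i i.
  move=> hij; apply: (mulfI hij).
  have := congr1 (fun g => GLmx g i j) hst.
  by rewrite !GLmxM mulmx_diagr// mulmx_diagl// [RHS]mulrC.
have [f fP] := choice (GL_col_neq0 h).
have fI : injective f 
  by move=> i j ij; apply: sr; rewrite (E _ _ (fP i)) ij -(E _ _ (fP j)).
exists (perm fI); apply/is_diag_mxP => i j /eqP ij.
rewrite GLmxM -row_permE mxE permE; apply/eqP; apply: contrapT => /negP hij.
by apply: ij; congr val; apply: fI; apply: tr; rewrite -(E _ _ hij) -(E _ _ (fP j)).
Qed.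

Section Finite.
Variables (K : {fset Q}) (Kring : fset_subring K).

Definition torus : {fset GL Q n} := [fset g in GLfset n K | is_diag_mx (GLmx g)]%fset.

Lemma in_torus g : (g \in torus) = (g \in GLfset n K) && is_diag_mx (GLmx g).
Proof. by rewrite !inE. Qed.

Lemma sub_torus : {subset torus <= GLfset n K}.
Proof. by move=> g; rewrite in_torus => /andP[]. Qed.

Lemma torus_diag g : g \in torus -> is_diag_mx (GLmx g).
Proof. by rewrite in_torus => /andP[]. Qed.

Lemma torus_subgroup : fset_subgroup torus.
Proof.
have [H1 HM _] := GLfset_subgroup n Kring.
apply: fset_submonoid_subgroup; first by rewrite in_torus H1 scalar_mx_is_diag.
move=> g h; rewrite !in_torus => /andP[gH /is_diag_mxP gd] /andP[hH /is_diag_mxP hd].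
rewrite HM//; apply/is_diag_mxP => i j ij.
by rewrite GLmxM mulmx_diagl ?hd ?mulr0//; exact/is_diag_mxP.
Qed.

Lemma torus_comm : {in torus &, forall s t, s * t = t * s}%g.
Proof.
move=> s t; rewrite !in_torus => /andP[_ sd] /andP[_ td].
apply: val_inj; apply/matrixP => i j; rewrite /= mulmx_diagl// mulmx_diagr// mulrC.
by have [->//|/(is_diag_mxP td) ->] := eqVneq i j; rewrite !mul0r.
Qed.

Lemma perm_GL_GLfset w : perm_GL w \in GLfset n K.
Proof.
apply/in_GLfset => i j; rewrite !mxE; case: (_ == _); last exact: fset_subring0.
by case: Kring.
Qed.

Lemma torus_scale i (c : Q) : c \in K -> c != 0 ->
  exists2 e, e \in torus & forall k, GLmx e k k = if k == i then c else 1.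
Proof.
move=> cK c0; pose A : 'M[Q]_n := diag_mx (\row_k if k == i then c else 1).
have AU : A \in unitmx.
  rewrite unitmxE det_diag unitfE; apply/prodf_neq0 => k _; rewrite mxE.
  by case: ifP; rewrite ?oner_neq0.
exists (MkGL AU); last by move=> k; rewrite !mxE eqxx.
rewrite in_torus diag_mx_is_diag andbT; apply/in_GLfset => k l; rewrite !mxE.
case: Kring => K1 _ _.
by case: (k == l); rewrite ?mulr0n ?mulr1n ?fset_subring0//; case: ifP.
Qed.

Variable R : realFieldType.

(** Scaling the i-th entry by c in K^* permutes the torus, and for a given t at
most one c makes the i-th entry equal to the j-th one. *)
Lemma sum_torus_eq_le i j : i != j ->
  (#|` K|.-1)%:R * \sum_(t <- torus) (GLmx t i i == GLmx t j j)%:R <= #|` torus|%:R :> R.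
Proof.
move=> ij; have cardK : (#|` K|.-1)%:R = \sum_(c <- (K `\ 0)%fset) 1 :> R.
  by rewrite card_fset_sumR [#|` K|](cardfsD1 0) fset_subring0.
rewrite cardK mulr_suml -card_fset_sumR.
apply: (@le_trans _ _ (\sum_(c <- (K `\ 0)%fset) \sum_(t <- torus)
    (c * GLmx t i i == GLmx t j j)%:R)).
  apply: ler_sum_fset => c; rewrite !inE => /andP[c0 cK]; rewrite mul1r.
  have [e eT eE] := torus_scale i cK c0.
  rewrite -(sum_mulgl torus_subgroup (fun t => (GLmx t i i == GLmx t j j)%:R) eT).
  have := eT; rewrite in_torus => /andP[_ ed].
  apply: ler_sum_fset => t tT; rewrite GLmxM !mulmx_diagl// !eE eqxx.
  by rewrite eq_sym in ij; rewrite (negbTE ij) mul1r.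
rewrite exchange_big/=; apply: ler_sum_fset => t tT.
have ti0 : GLmx t i i != 0.
  have [k] := GL_col_neq0 t i; apply: contra_neq => ti.
  have [->//|ki] := eqVneq k i.
  by move: tT; rewrite in_torus => /andP[_ /is_diag_mxP ->].
under eq_bigr do rewrite -[_%:R]mulr1.
rewrite -sum_indicator (eq_bigl (pred1 (GLmx t j j / GLmx t i i))); last first.
  by move=> c /=; rewrite eq_sym -(can2_eq (mulfK ti0) (mulfVK ti0)) eq_sym.
rewrite big_const_seq count_uniq_mem ?fset_uniq// iter_addr_0.
by case: (_ \in _).
Qed.

Lemma sum_torus_irregular_le : (1 < #|` K|)%N ->
  \sum_(t <- torus) (~~ diag_regular t)%:R <=
  (n ^ 2)%:R / (#|` K|.-1)%:R * #|` torus|%:R :> R.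
Proof.
move=> K1; have K0 : 0 < (#|` K|.-1)%:R :> R by rewrite ltr0n -subn1 subn_gt0.
rewrite mulrAC ler_pdivlMr// mulr_suml.
apply: (@le_trans _ _ (\sum_(ij : 'I_n * 'I_n | ij.1 != ij.2)
    (#|` K|.-1)%:R * \sum_(t <- torus) (GLmx t ij.1 ij.1 == GLmx t ij.2 ij.2)%:R)).
  under [leRHS]eq_bigr do rewrite mulr_sumr.
  rewrite exchange_big/=; apply: ler_sum => t _; rewrite -mulr_sumr mulrC.
  rewrite ler_wpM2l ?ler0n//.
  have [_|] := boolP (diag_regular t); first exact: sumr_ge0.
  move=> /forallPn[i /forallPn[j]]; rewrite negb_imply => /andP[tij ij].
  by rewrite (bigD1 (i, j))//= tij lerDl sumr_ge0.
apply: (@le_trans _ _ (\sum_(ij : 'I_n * 'I_n) #|` torus|%:R)).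
  rewrite [leLHS]big_mkcond; apply: ler_sum => -[i j] _ /=.
  by case: ifP => // ij; exact: sum_torus_eq_le.
by rewrite sumr_const card_prod card_ord mulnn -[leLHS]mulr_natl.
Qed.

(** The sum of phi(g ^ 2) over all pairs (h, t) with t regular and
g = h t h^-1 is bounded below by sum_squares_conj, after discarding the
irregular t, and above by sum_conjugates_le, where the permutation matrices
provide n! cosets. *)
Lemma sum_squares_GLfset (phi : GL Q n -> R) (m : R) : (1 < #|` K|)%N ->
  {in GLfset n K, forall g, 0 <= phi g <= 1} ->
  mean_positive (GLfset n K) phi m ->
  #|` GLfset n K|%:R * (m - (n ^ 2)%:R / (#|` K|.-1)%:R) <=
  n`!%:R * \sum_(g <- GLfset n K) phi (g * g)%g.
Proof.
move=> K1 phi01 phim.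
have Hgrp := GLfset_subgroup n Kring; have [H1 HM HV] := Hgrp.
have Tgrp := torus_subgroup; have [T1 _ _] := Tgrp.
have T0 : 0 < #|` torus|%:R :> R by rewrite ltr0n cardfs_gt0; apply/fset0Pn; exists 1%g.
rewrite -(ler_pM2r T0) [leRHS]mulrAC -natrM -card_Sn.
apply: le_trans (sum_conjugates_le (w := perm_GL) (reg := diag_regular)
  (F := fun g => phi (g * g)%g) Hgrp sub_torus perm_GL_GLfset _ _); last 2 first.
- move=> h s t hH sT tT sr tr hst.
  have [w wd] := regular_diag_conj_monomial (torus_diag sT) (torus_diag tT) sr tr hst.
  by exists w; rewrite in_torus HM// perm_GL_GLfset.
- by move=> g gH; have /andP[] := phi01 _ (HM _ _ gH gH).
rewrite -card_fset_sumR mulrAC -mulrA mulr_suml; apply: ler_sum_fset => h hH.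
rewrite mul1r mulrBr lerBlDr.
have := sum_squares_conj Hgrp Tgrp sub_torus torus_comm hH phim.
move=> /le_trans; apply; rewrite (bigID diag_regular)/= lerD2l.
rewrite mulrC; apply: le_trans (sum_torus_irregular_le K1).
rewrite sum_indicator; apply: ler_sum_fset => t /sub_torus tH.
rewrite ler_piMr ?ler0n//.
by have /andP[] : 0 <= phi (h * t * h^-1 * (h * t * h^-1))%g <= 1
  by apply: phi01; rewrite !(HM, HV).
Qed.

End Finite.
End SplitTorus.

(** * Return measures are positive definite *)

Section MeasurePreserving.
Variables (R : realType) (d : measure_display) (X : measurableType d).
Variable mu : probability X R.

(** Integration, for inequalities between combinations of indicators; it
reduces Cauchy_Schwarz_measure to a pointwise inequality. *)
Lemma indic_combination_le (I J : Type) (r : seq I) (s : seq J)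
    (a : I -> R) (A : I -> set X) (b : J -> R) (B : J -> set X) :
  (forall i, 0 <= a i) -> (forall j, 0 <= b j) ->
  (forall i, measurable (A i)) -> (forall j, measurable (B j)) ->
  (forall x, \sum_(i <- r) a i * \1_(A i) x <= \sum_(j <- s) b j * \1_(B j) x) ->
  \sum_(i <- r) a i * fine (mu (A i)) <= \sum_(j <- s) b j * fine (mu (B j)).
Proof.
have E (K : Type) (t : seq K) (c : K -> R) (C : K -> set X) :
    (forall k, 0 <= c k) -> (forall k, measurable (C k)) ->
    measurable_fun setT
      (fun x => (\sum_(k <- t) ((c k)%:E * (\1_(C k) x)%:E))%E : \bar R) /\
    (\int[mu]_x (\sum_(k <- t) ((c k)%:E * (\1_(C k) x)%:E)) =
     (\sum_(k <- t) c k * fine (mu (C k)))%:E)%E.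
  move=> c0 Cm.
  have m1 k : measurable_fun setT (fun x => (\1_(C k) x)%:E : \bar R).
    exact/measurable_EFinP/measurable_realfun.measurable_indic.
  have mf k : measurable_fun setT (fun x => ((c k)%:E * (\1_(C k) x)%:E)%E : \bar R).
    exact: measurable_funeM.
  split; first exact: emeasurable_sum.
  rewrite ge0_integral_sum//; last by move=> k x _; apply: mule_ge0; rewrite lee_fin.
  rewrite -sumEFin; apply: eq_bigr => k _.
  rewrite ge0_integralZl_EFin//.
  by rewrite integral_indic// setIT EFinM fineK// fin_num_measure.
move=> a0 b0 Am Bm AB.
have [mA IA] := E _ r a A a0 Am; have [mB IB] := E _ s b B b0 Bm.
rewrite -lee_fin -IA -IB; apply: ge0_le_integral => //.
  by move=> x _; apply: sume_ge0 => i _; apply: mule_ge0; rewrite lee_fin.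
move=> x _; under eq_bigr do rewrite -EFinM.
under [leRHS]eq_bigr do rewrite -EFinM.
by rewrite !sumEFin lee_fin.
Qed.

(** With f the sum of the indicators of the A i and c its integral, integrate
2 c f <= f ^ 2 + c ^ 2. *)
Lemma Cauchy_Schwarz_measure (I : Type) (r : seq I) (A : I -> set X) :
  (forall i, measurable (A i)) ->
  (\sum_(i <- r) fine (mu (A i))) ^+ 2 <=
  \sum_(i <- r) \sum_(j <- r) fine (mu (A i `&` A j)).
Proof.
move=> Am; set c := \sum_(i <- r) fine (mu (A i)).
have c0 : 0 <= c by apply: sumr_ge0 => i _; exact/fine_ge0/measure_ge0.
(* [None] carries the constant c ^ 2, the other indices the terms of f ^ 2. *)
pose B (x : option (I * I)) := if x is Some ij then A ij.1 `&` A ij.2 else setT.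
pose b (x : option (I * I)) : R := if x is Some _ then 1 else c ^+ 2.
pose s := None :: [seq Some (i, j) | i <- r, j <- r].
have sumS (F : option (I * I) -> R) :
    \sum_(x <- s) F x = F None + \sum_(i <- r) \sum_(j <- r) F (Some (i, j)).
  by rewrite /s big_cons big_allpairs_dep.
have /(@indic_combination_le I _ r s (fun=> c *+ 2) A b B) : forall x,
    \sum_(i <- r) c *+ 2 * \1_(A i) x <= \sum_(j <- s) b j * \1_(B j) x.
  move=> x; rewrite -mulr_sumr sumS /= indicT mulr1.
  set f := \sum_(i <- r) \1_(A i) x.
  have -> : \sum_(i <- r) \sum_(j <- r) 1 * \1_(A i `&` A j) x = f ^+ 2.
    rewrite expr2 mulr_suml; apply: eq_bigr => i _; rewrite mulr_sumr.
    by apply: eq_bigr => j _; rewrite mul1r indicI.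
  by have := sqr_ge0 (c - f); lra.
rewrite -mulr_sumr -/c sumS /= probability_setT /= mulr1 => L.
rewrite -(lerD2l (c ^+ 2)); apply: le_trans (le_trans (L _ _ _ _) _).
- by rewrite mulrnAl -expr2 mulr2n.
- by move=> _; exact: mulrn_wge0.
- by case=> [ij|] //=; exact: sqr_ge0.
- exact: Am.
- by case=> [ij|] //=; exact: measurableI.
rewrite lerD2l le_eqVlt; apply/orP; left; apply/eqP.
by apply: eq_bigr => i _; apply: eq_bigr => j _; rewrite mul1r.
Qed.

Variables (G : groupType) (T : G -> X -> X) (Y : set X).
Hypothesis (Tsys : measure_preserving_system mu T) (mY : measurable Y).

Lemma image_action g : T g @` Y = T g^-1%g @^-1` Y.
Proof.
have [T1 TM _] := Tsys; apply/seteqP; split=> [_ [y Yy <-]|x /= Yx].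
  by rewrite /= -[T _ (T _ _)]/((T g^-1%g \o T g) y) -TM mulVg T1.
exists (T g^-1%g x) => //.
by rewrite -[T _ (T _ _)]/((T g \o T g^-1%g) x) -TM mulgV T1.
Qed.

Lemma measurable_image_action g : measurable (T g @` Y).
Proof.
have [_ _ /(_ g^-1%g)[Tm _]] := Tsys.
by rewrite image_action -[X in measurable X]setTI; exact: Tm.
Qed.

Lemma measure_image_action g : mu (T g @` Y) = mu Y.
Proof. by rewrite image_action; have [_ _ /(_ g^-1%g)[_ ->]] := Tsys. Qed.

Lemma mean_positive_return_measure (H : {fset G}) :
  mean_positive H (fun g => fine (mu (Y `&` T g @` Y))) (fine (mu Y) ^+ 2).
Proof.
have [T1 TM Tmp] := Tsys.
move=> s _; have := Cauchy_Schwarz_measure s measurable_image_action.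
under eq_bigr do rewrite measure_image_action.
rewrite big_const_seq count_predT iter_addr_0.
rewrite -[X in X ^+ 2 <= _]mulr_natl exprMn => /le_trans; apply.
rewrite le_eqVlt; apply/orP; left; apply/eqP.
apply: eq_bigr => a _; apply: eq_bigr => b _; congr fine.
have mYab : measurable (Y `&` T (a^-1 * b)%g @` Y).
  by apply: measurableI => //; exact: measurable_image_action.
rewrite -[RHS]((Tmp a^-1%g).2 _ mYab) !image_action; congr (mu _).
rewrite preimage_setI; congr (_ `&` _).
by rewrite invgM invgK -comp_preimage -TM mulgK.
Qed.

End MeasurePreserving.

(** * A reverse Fatou lemma along an ultrafilter *)

Lemma sum_geometric_half (R : numFieldType) (a : R) i :
  \sum_(j < i) a / 2 ^+ j.+1 = a - a / 2 ^+ i.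
Proof.
elim: i => [|i IH]; first by rewrite big_ord0 expr0 divr1 subrr.
rewrite big_ord_recr/= IH exprS invfM.
have -> : a / 2 ^+ i = a * (2^-1 * (2 ^+ i)^-1) + a * (2^-1 * (2 ^+ i)^-1).
  by rewrite -mulrDr -mulrDl -[2^-1]mul1r -splitr mul1r.
by rewrite opprD addrA subrK.
Qed.

Section FinitaryFatou.
Variables (R : realType) (Omega : choiceType) (S : nat -> {fset Omega}).
Hypothesis S_neq0 : forall M, S M != fset0.

Definition average M (f : Omega -> R) : R := (\sum_(x <- S M) f x) / #|` S M|%:R.

Let card_gt0 M : 0 < #|` S M|%:R :> R.
Proof. by rewrite ltr0n cardfs_gt0 S_neq0. Qed.

Lemma le_average M f g : (forall x, f x <= g x) -> average M f <= average M g.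
Proof. by move=> fg; rewrite ler_pM2r ?invr_gt0//; exact: ler_sum. Qed.

Lemma averageD M f g : average M (fun x => f x + g x) = average M f + average M g.
Proof. by rewrite /average big_split mulrDl. Qed.

Lemma averageB M f g : average M (fun x => f x - g x) = average M f - average M g.
Proof. by rewrite /average sumrB mulrBl. Qed.

Lemma averageZ M a f : average M (fun x => a * f x) = a * average M f.
Proof. by rewrite /average -mulr_sumr mulrA. Qed.

Lemma average_cst M a : average M (fun=> a) = a.
Proof.
rewrite /average big_const_seq count_predT iter_addr_0.
rewrite -[X in X / _]mulr_natr -mulrA divff ?mulr1//.
exact: lt0r_neq0.
Qed.

Lemma average_sum M (I : finType) (f : I -> Omega -> R) :
  average M (fun x => \sum_i f i x) = \sum_i average M (f i).
Proof. by rewrite /average exchange_big mulr_suml. Qed.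

Variables (U : set_system nat) (f : nat -> Omega -> R) (c : R).
Hypotheses (UU : UltraFilter U) (c_ge0 : 0 <= c) (f_le1 : forall k x, f k x <= 1).
Hypothesis f_large : forall e : R, 0 < e -> forall m,
  exists2 k, (m <= k)%N & U [set M | c - e <= average M (f k)].

(** The value f k x comes within e of c for some k in the window [j, K). *)
Definition hit (e : R) j K x : bool := has (fun k => c - e <= f k x) (index_iota j K).

Let ind (b : Omega -> bool) x : R := (b x)%:R.

Lemma hitP e j K x :
  reflect (exists k, [/\ (j <= k)%N, (k < K)%N & c - e <= f k x]) (hit e j K x).
Proof.
apply: (iffP hasP) => [[k]|[k [jk kK ck]]]; last first.
  by exists k; rewrite // mem_index_iota jk.
by rewrite mem_index_iota => /andP[jk kK] ck; exists k.
Qed.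

Let ultraI A B : U A -> U B -> U (A `&` B).
Proof. exact: filterI. Qed.

Let ultra_ex A : U A -> exists M, A M.
Proof. exact: filter_ex. Qed.

Let ultra_forall (I : finType) (P : I -> set nat) :
  (forall i, U (P i)) -> U [set M | forall i, P i M].
Proof. by move=> UP; apply: filter_forall. Qed.

Let ultra_ge (u v : nat -> R) :
  ~ U [set M | u M <= v M] -> U [set M | v M < u M].
Proof.
move=> nuv; case: (in_ultra_setVsetC [set M | u M <= v M] UU) => // H.
by apply: filterS H => M /= /negP; rewrite -ltNge.
Qed.

(** In the limit this says that limsup f >= c has positive probability.  If
not, there is e0 for which limsup f >= c - e0 has probability at most 1/2, and
then e1 for which limsup f >= c - e1 has probability at most e0 / 4.  Off the
first event f is eventually below c - e0, off the second one below c, so the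
mean of f is eventually below c - e0 + e0 / 2 + e0 / 4, which is less than
c. *)
Lemma hit_average_bounded_below : exists2 a : R, 0 < a &
  forall e : R, 0 < e -> forall j, exists K,
    U [set M | a <= average M (ind (hit e j K))].
Proof.
apply: contrapT => H.
have {}H (a : R) : 0 < a -> exists (e : R) (j : nat), 0 < e /\
    forall K, U [set M | average M (ind (hit e j K)) < a].
  move=> a0; apply: contrapT => N; apply: H; exists a => // e e0 j.
  apply: contrapT => /forallNP NK; apply: N; exists e, j; split=> // K.
  exact: (@ultra_ge (fun=> a)).
have [e0 [j0 [e0_gt0 h0]]] := H 2^-1 ltac:(lra).
have [e1 [j1 [e1_gt0 h1]]] := H (e0 / 4) ltac:(lra).
have [k jk ck] := f_large (e := e0 / 8) ltac:(lra) (maxn j0 j1).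
have /ultra_ex[M [[h0M h1M] ckM]] := ultraI (ultraI (h0 k.+1) (h1 k.+1)) ck.
have : average M (f k) <= average M (fun x => (c - e0) +
    (e0 * ind (hit e0 j0 k.+1) x + ind (hit e1 j1 k.+1) x)).
  apply: le_average => x; have := f_le1 k x; have := c_ge0 => c0 fk1.
  move: jk; rewrite geq_max => /andP[j0k j1k].
  have hk e j : (j <= k)%N -> c - e <= f k x -> hit e j k.+1 x.
    by move=> jk ce; apply/hitP; exists k; rewrite jk ltnSn.
  rewrite /ind; have [fe0|fe0] := leP (c - e0) (f k x).
    rewrite (hk e0)//; have [fe1|fe1] := leP (c - e1) (f k x).
      by rewrite (hk e1)//= !mulr1n; lra.
    by case: (hit e1 _ _ _) => /=; rewrite ?mulr1n ?mulr0n; lra.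
  by case: (hit e0 _ _ _); case: (hit e1 _ _ _) => /=; rewrite ?mulr1n ?mulr0n; lra.
rewrite !(averageD, averageZ, average_cst) /=.
have : e0 * average M (ind (hit e0 j0 k.+1)) <= e0 * 2^-1 by rewrite ler_pM2l// ltW.
by move: h0M h1M ckM => /=; lra.
Qed.

(** Otherwise one could raise the average by eta again and again by enlarging
the window, beyond its maximal value 1. *)
Lemma hit_average_saturates (e eta : R) j : 0 < eta -> exists K, forall K',
  U [set M | average M (ind (hit e j K')) < average M (ind (hit e j K)) + eta].
Proof.
move=> eta0; apply: contrapT => /forallNP N.
have {}N K : exists K', U [set M |
    average M (ind (hit e j K)) + eta <= average M (ind (hit e j K'))].
  have /existsNP[K' NK'] := N K; exists K'.
  case: (in_ultra_setVsetC [set M |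
    average M (ind (hit e j K)) + eta <= average M (ind (hit e j K'))] UU) => // H.
  exfalso; apply: NK'; apply: filterS H => M /= /negP.
  by rewrite -ltNge.
have climb m : exists K, U [set M | m%:R * eta <= average M (ind (hit e j K))].
  elim: m => [|m [K HK]].
    exists 0%N; apply: filterE => M; rewrite mul0r -(average_cst M 0).
    exact: le_average.
  have [K' HK'] := N K; exists K'.
  by apply: filterS2 HK HK' => M /=; rewrite -natr1 mulrDl; lra.
have [K /ultra_ex[M HM]] := climb (Num.truncn eta^-1).+1.
have : average M (ind (hit e j K)) <= 1.
  by rewrite -[leRHS](average_cst M); apply: le_average => x; rewrite /ind; case: hit.
have := truncnS_gt eta^-1; rewrite -(ltr_pM2r eta0) mulVf ?lt0r_neq0//.
by move: HM => /=; lra.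
Qed.

(** The windows [j, K j) are chosen so that enlarging the j-th one increases the
probability of its event E j by less than a / 2 ^ (j + 1), where a comes from
hit_average_bounded_below.  Since E i is contained in the event E' j of the
enlarged j-th window, it meets the complement of E j in a set of probability
less than a / 2 ^ (j + 1), for each j < i.  These bounds sum to less than the
probability of E i, so some x lies in all the E j with j <= i. *)
Lemma finitary_Fatou : exists K : nat -> nat, forall i, exists x,
  forall j, (j <= i)%N ->
  exists k, [/\ (j <= k)%N, (k < K j)%N & c - j.+1%:R^-1 <= f k x].
Proof.
have [a a0 aP] := hit_average_bounded_below.
have eta0 j : 0 < a / 2 ^+ j.+1 by rewrite divr_gt0// exprn_gt0.
have /choice[K KP] j := hit_average_saturates (j.+1%:R^-1) j (eta0 j).
exists K => i; apply: contrapT => /forallNP none.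
pose E j := hit j.+1%:R^-1 j (K j).
have noneE x : exists2 j, (j <= i)%N & ~~ E j x.
  apply: contrapT => all; apply: (none x) => j ji.
  by apply/hitP; apply: contrapT => /negP Ej; apply: all; exists j.
pose E' (j : 'I_i) := hit j.+1%:R^-1 j (maxn (K i) (K j)).
have E_le x : ind (E i) x <= \sum_(j < i) (ind (E' j) x - ind (E j) x).
  have EE' (j : 'I_i) : 0 <= ind (E' j) x - ind (E j) x.
    rewrite subr_ge0 /ind; case Ej : (E j x) => //; suff -> : E' j x by [].
    move/hitP : Ej => [k [jk kK ck]]; apply/hitP; exists k; split=> //.
    by rewrite leq_max kK orbT.
  rewrite {1}/ind; case Ei : (E i x); last by apply: sumr_ge0.
  have [j ji Ej] := noneE x.
  have ji' : (j < i)%N.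
    by rewrite ltn_neqAle ji andbT; apply: contraNneq Ej => ->; rewrite Ei.
  rewrite (bigD1 (Ordinal ji'))//= {2}/ind (negbTE Ej) subr0 /ind.
  have -> : E' (Ordinal ji') x.
    move/hitP : Ei => [k [ik kK ck]]; apply/hitP; exists k; split.
    - exact: leq_trans ik.
    - by rewrite leq_max kK.
    - apply: le_trans ck; rewrite lerB// lef_pV2 ?posrE ?ltr0n//.
      by rewrite ler_nat ltnS.
  by rewrite lerDl; apply: sumr_ge0 => j' _; exact: EE'.
have [Ka aK] := aP i.+1%:R^-1 ltac:(by rewrite invr_gt0 ltr0n) i.
have /ultra_ex[M [[aM iM] jM]] := ultraI (ultraI aK (KP i Ka))
  (ultra_forall (fun j : 'I_i => KP j (maxn (K i) (K j)))).
have := le_average M E_le; rewrite average_sum.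
under eq_bigr do rewrite averageB.
apply/negP; rewrite -ltNge.
apply: (@le_lt_trans _ _ (\sum_(j < i) a / 2 ^+ j.+1)).
  by apply: ler_sum => j _; rewrite lerBlDl ltW//; exact: jM.
rewrite sum_geometric_half.
have : 0 < a / 2 ^+ i by rewrite divr_gt0// exprn_gt0.
move: aM iM => /=; rewrite exprS invfM; rewrite /E; lra.
Qed.

End FinitaryFatou.

(** * Left Banach density and cosets of finite subgroups *)

Section BanachDensity.
Variables (R : realType) (G : groupType).
Implicit Types (H F : {fset G}) (A E : set G).

Lemma card_fset_sep (T : choiceType) (F : {fset T}) (P : pred T) :
  #|` [fset x in F | P x]%fset|%:R = \sum_(x <- F) (P x)%:R :> R.
Proof.
rewrite -card_fset_sumR -big_fset_condE sum_indicator.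
by apply: eq_bigr => x _; rewrite mulr1.
Qed.

(** A point of F outside g F lies in the symmetric difference; any other one is
g x for some x in F, and x is counted in the first term if g x is in A. *)
Lemma card_sep_translate F A g :
  (#|` [fset x in F | x \in A]| <= #|` [fset x in F | (g * x)%g \in A]| +
     #|` fset_symdiff (left_translate g F) F|)%N%fset.
Proof.
pose F' := [fset x in F | (g * x)%g \in A]%fset.
apply: (@leq_trans #|` left_translate g F' `|` fset_symdiff (left_translate g F) F|)%fset.
  apply/fsubset_leq_card/fsubsetP => x; rewrite !inE /= => /andP[xF xA].
  rewrite xF; have [/imfsetP[/= y yF xy]|] := 
    boolP (x \in left_translate g F); last first.
    by rewrite orbT.
  apply/orP; left; apply/imfsetP; exists y => //=.
  by rewrite !inE yF -xy xA.
apply: leq_trans (leq_card_fsetU _ _) _.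
by rewrite leq_add2r leq_imfset_card.
Qed.

Definition coset_density H A (y : G) : R :=
  #|` [fset h in H | (h * y)%g \in A]%fset|%:R / #|` H|%:R.

(** A Folner set F is almost invariant under every h in H, so the density of A
in F is nearly the average over x in F of the density of A in the coset H x.
The y that maximizes the density in H y works for all Folner sequences. *)
Lemma upper_left_Banach_density_le_coset H A : H != fset0 ->
  exists y, (upper_left_Banach_density R A <= (coset_density H A y)%:E)%E.
Proof.
move=> Hn0; have H0 : 0 < #|` H|%:R :> R by rewrite ltr0n cardfs_gt0.
pose cnt y := #|` [fset h in H | (h * y)%g \in A]%fset|.
have cnt_le y : (cnt y <= #|` H|)%N.
  by apply/fsubset_leq_card/fsubsetP => h; rewrite !inE => /andP[].
have exP : exists v, `[< exists y, cnt y = v >].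
  by exists (cnt 1%g); apply/asboolP; exists 1%g.
have leP v : `[< exists y, cnt y = v >] -> (v <= #|` H|)%N.
  by move=> /asboolP[y <-]; exact: cnt_le.
case: (ex_maxnP exP leP) => v /asboolP[y yv] vmax; exists y.
have {}vmax z : (cnt z <= v)%N by apply: vmax; apply/asboolP; exists z.
rewrite /coset_density -/(cnt y) yv.
apply: ge_ereal_sup => _ [F [Fn0 FF] <-].
apply: limn_esup_le => e e0.
have : \forall N \near \oo, forall h : H,
    #|` fset_symdiff (left_translate (fsval h) (F N)) (F N)|%:R / #|` F N|%:R <= e.
  apply: filter_forall => h.
  have /cvgrPdist_le/(_ e e0) := FF (fsval h).
  by apply: filterS => N; rewrite sub0r normrN; apply: le_trans; exact: ler_norm.
apply: filterS => N small; rewrite lee_fin.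
have FN0 : 0 < #|` F N|%:R :> R by rewrite ltr0n cardfs_gt0.
rewrite ler_pdivrMr// mulrDl -(ler_pM2l H0) mulrDr.
have -> : #|` H|%:R * (v%:R / #|` H|%:R * #|` F N|%:R) = v%:R * #|` F N|%:R :> R.
  by rewrite -mulrA mulrCA mulVKf ?lt0r_neq0.
apply: (@le_trans _ _ (\sum_(h <- H)
    (#|` [fset x in F N | (h * x)%g \in A]%fset|%:R + e * #|` F N|%:R))).
  rewrite -card_fset_sumR mulr_suml; apply: ler_sum_fset => h hH; rewrite mul1r.
  apply: le_trans (_ : _ <= (_ + _)%:R) _; first by
    rewrite ler_nat; exact: (card_sep_translate _ _ h).
  rewrite natrD lerD2l -ler_pdivrMr//; exact: (small (FSetSub hH)).
rewrite big_split/= big_const_seq count_predT iter_addr_0.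
rewrite -[X in _ + X <= _]mulr_natl lerD2r.
under eq_bigr do rewrite card_fset_sep.
rewrite exchange_big/= -card_fset_sumR mulr_sumr; apply: ler_sum_fset => x _.
by rewrite -card_fset_sep mulr1 ler_nat vmax.
Qed.

Lemma upper_density_ge0 (F : nat -> {fset G}) E : (0 <= upper_density R F E)%E.
Proof.
apply: limf_esup_ge0; last by move=> N; rewrite lee_fin.
by move=> H; have /filter_ex[] := H.
Qed.

End BanachDensity.

(** * Recurrence and intersectivity along squares in locally finite groups *)

Section LocallyFiniteGroup.
Variables (R : realType) (G : groupType) (H : nat -> {fset G}).
Hypothesis Hgrp : forall k, fset_subgroup (H k).
Hypothesis H_mono : forall k l, (k <= l)%N -> {subset H k <= H l}.
Hypothesis H_exhaust : forall g : G, exists k, g \in H k.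

Let H_neq0 k : H k != fset0.
Proof. by apply/fset0Pn; exists 1%g; have [] := Hgrp k. Qed.

Let card_H_gt0 k : 0 < #|` H k|%:R :> R.
Proof. by rewrite ltr0n cardfs_gt0. Qed.

Lemma two_sided_Folner_subgroups : two_sided_Folner R H.
Proof.
have symdiff0 (g : G) (tr : G -> {fset G} -> {fset G}) :
    (forall k, g \in H k -> tr g (H k) = H k) ->
    (#|` fset_symdiff (tr g (H k)) (H k)|%:R / #|` H k|%:R : R) @[k --> \oo] --> (0 : R).
  move=> trH; apply/cvgrPdist_le => e e0; have [k0 gk0] := H_exhaust g.
  exists k0 => // k /= k0k; rewrite trH; last exact: H_mono gk0.
  by rewrite /fset_symdiff fsetDv fsetUid cardfs0 mul0r subrr normr0 ltW.
split; split=> // g.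
- apply: (symdiff0 g (@left_translate G)) => k gk.
  apply: imfset_endo => [h hk|h h' _ _ /mulgI//].
  by have [_ HM _] := Hgrp k; exact: HM.
- apply: (symdiff0 g (fun g F => right_translate F g)) => k gk.
  apply: imfset_endo => [h hk|h h' _ _ /mulIg//].
  by have [_ HM _] := Hgrp k; exact: HM.
Qed.

(** Uniformity in phi is what allows the same estimate to serve for return
measures, which do not depend on k, and for correlations along cosets of the
groups H M with M >= k, which do. *)
Definition square_recurrent (kappa : R) : Prop :=
  forall e : R, 0 < e -> exists k0, forall k, (k0 <= k)%N ->
  forall (phi : G -> R) (m : R),
    {in H k, forall g, 0 <= phi g <= 1} -> mean_positive (H k) phi m ->
    kappa * m - e <= (\sum_(g <- H k) phi (g * g)%g) / #|` H k|%:R.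

Variables (kappa : R) (kappa_ge0 : 0 <= kappa) (Hsq : square_recurrent kappa).

Lemma square_recurrence (d : measure_display) (X : measurableType d)
    (mu : probability X R) (T : G -> X -> X) (Y : set X) :
  measure_preserving_system mu T -> measurable Y ->
  (mu Y ^+ 2 * kappa%:E <= limn_esup (fun N =>
     (#|` H N|%:R^-1)%:E * \sum_(g <- H N) mu (Y `&` (T g \o T g) @` Y)))%E.
Proof.
move=> Tsys mY; have [T1 TM _] := Tsys.
have muYE : mu Y = (fine (mu Y))%:E by rewrite fineK// fin_num_measure.
rewrite muYE -EFin_expe -EFinM mulrC; apply: le_limn_esup => e e0 m.
have [k0 k0P] := Hsq e0; exists (maxn m k0); first exact: leq_maxl.
have mI g : measurable (Y `&` T g @` Y).
  by apply: measurableI => //; exact: (measurable_image_action Tsys).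
have -> : (\sum_(g <- H (maxn m k0)) mu (Y `&` (T g \o T g) @` Y) =
    (\sum_(g <- H (maxn m k0)) fine (mu (Y `&` T (g * g)%g @` Y)))%:E)%E.
  by rewrite -sumEFin; apply: eq_bigr => g _; rewrite TM fineK// -TM fin_num_measure.
rewrite -EFinM lee_fin [leRHS]mulrC.
apply: (k0P _ (leq_maxr _ _) (fun g => fine (mu (Y `&` T g @` Y)))).
  move=> g _; rewrite fine_ge0//= -lee_fin fineK ?fin_num_measure//.
  exact: probability_le1.
exact: mean_positive_return_measure.
Qed.

Section Intersectivity.
Variables (A : set G).

Let delta : R := fine (upper_left_Banach_density R A).

Lemma Banach_density_cosets : upper_left_Banach_density R A = delta%:E /\ 0 <= delta /\
  exists y : nat -> G, forall M, delta <= coset_density R (H M) A (y M).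
Proof.
have /choice[y yP] M := upper_left_Banach_density_le_coset R A (H_neq0 M).
have D0 : (0 <= upper_left_Banach_density R A)%E.
  apply: le_trans (upper_density_ge0 R H A) _; apply: ereal_sup_ubound; exists H => //.
  by have [] := two_sided_Folner_subgroups.
have DE : upper_left_Banach_density R A = delta%:E.
  rewrite /delta fineK// ge0_fin_numE//.
  exact: le_lt_trans (yP 0%N) (ltry _).
split=> //; split; first by rewrite -lee_fin -DE.
by exists y => M; rewrite -lee_fin -DE.
Qed.

(** The analogue of mu(Y :&: T_(g^-1) Y), for the trace of A on H M y. *)
Definition coset_correlation (M : nat) (y g : G) : R :=
  (\sum_(h <- H M) ((h * y)%g \in A)%:R * ((g * h * y)%g \in A)%:R) / #|` H M|%:R.

Lemma coset_correlation_bounds M y g : 0 <= coset_correlation M y g <= 1.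
Proof.
rewrite /coset_correlation divr_ge0 ?ler0n//=; last first.
  by apply: sumr_ge0 => h _; rewrite mulr_ge0.
rewrite ler_pdivrMr// mul1r -card_fset_sumR; apply: ler_sum_fset => h _.
by case: (_ \in _); case: (_ \in _); rewrite ?mulr1 ?mulr0.
Qed.

(** After translation, the double sum is the mean over H M of the square of the
function counting the a in s with a^-1 h y in A; its own mean is N, the size of
s times the density of A in the coset. *)
Lemma mean_positive_coset_correlation M y :
  mean_positive (H M) (coset_correlation M y) (coset_density R (H M) A y ^+ 2).
Proof.
move=> s sH; have [_ HM HV] := Hgrp M.
pose u a h : R := ((a^-1 * h * y)%g \in A)%:R; pose v := \sum_(a <- s) u a.
pose d := coset_density R (H M) A y; pose N := (size s)%:R * d.
have sum_u a : a \in s -> \sum_(h <- H M) u a h = d * #|` H M|%:R.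
  move=> /sH aH; rewrite /u.
  rewrite (sum_mulgl (Hgrp M) (fun h => ((h * y)%g \in A)%:R) (HV _ aH)).
  by rewrite /d /coset_density card_fset_sep divfK// lt0r_neq0.
have -> : \sum_(a <- s) \sum_(b <- s) coset_correlation M y (a^-1 * b)%g =
    (\sum_(h <- H M) (\sum_(a <- s) u a h) ^+ 2) / #|` H M|%:R.
  rewrite mulr_suml.
  under [RHS]eq_bigr do rewrite expr2 mulr_suml mulr_suml.
  rewrite [RHS]exchange_big/=; apply: eq_big_seq => a aS.
  under [RHS]eq_bigr do rewrite mulr_sumr mulr_suml.
  rewrite [RHS]exchange_big/=; apply: eq_big_seq => b bS.
  rewrite /coset_correlation mulr_suml.
  rewrite -(sum_mulgl (Hgrp M) (fun h => _ * _ / _) (HV _ (sH _ bS))).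
  by apply: eq_bigr => h _; rewrite /u [X in X / _]mulrC -!mulgA mulVKg.
rewrite ler_pdivlMr// -exprMn -/d -/N.
have sumX : \sum_(h <- H M) \sum_(a <- s) u a h = N * #|` H M|%:R.
  rewrite exchange_big/= (eq_big_seq _ sum_u) big_const_seq count_predT iter_addr_0.
  by rewrite -[LHS]mulr_natl mulrA.
apply: (@le_trans _ _ (\sum_(h <- H M) (N *+ 2 * (\sum_(a <- s) u a h) - N ^+ 2))).
  rewrite sumrB -mulr_sumr sumX big_const_seq count_predT iter_addr_0.
  by rewrite -[X in _ <= _ - X]mulr_natr le_eqVlt; apply/orP; left; apply/eqP; ring.
by apply: ler_sum_fset => h _; have := sqr_ge0 ((\sum_(a <- s) u a h) - N); lra.
Qed.

(** The density in H k of the set B_x of all b such that b x and b^-1 x are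
in A. *)
Definition return_density k (x : G) : R :=
  #|` [fset b in H k | ((b * x)%g \in A) && ((b^-1 * x)%g \in A)]%fset|%:R / #|` H k|%:R.

(** Substitute b h for h in the sum over H M, which contains b. *)
Lemma average_return_density k M y : (k <= M)%N ->
  average (fun M => [fset (h * y M)%g | h in H M]%fset) M (return_density k) =
  (\sum_(b <- H k) coset_correlation M (y M) (b * b)%g) / #|` H k|%:R.
Proof.
move=> kM; have [_ HM HV] := Hgrp M.
have yI : injective (fun h => h * y M)%g by move=> h h' /mulIg.
rewrite /average card_imfset// big_imfset/=; last by move=> h h' _ _; exact: yI.
rewrite -!mulr_suml mulrAC; congr (_ / _ / _).
under eq_bigr do rewrite card_fset_sep.
rewrite exchange_big/=; apply: eq_big_seq => b bk.
rewrite -(sum_mulgl (Hgrp M) (fun h => (_ && _)%:R) (H_mono kM bk)).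
by apply: eq_bigr => h _; rewrite -mulnb natrM mulrC -!mulgA mulKg.
Qed.

Lemma square_intersectivity : exists B : set G,
  (upper_left_Banach_density R A ^+ 2 * kappa%:E <= upper_density R H B)%E /\
  [set (b * b')%g | b in B & b' in B] `<=` [set (a * a'^-1)%g | a in A & a' in A].
Proof.
have [-> [delta0 [y yP]]] := Banach_density_cosets.
have [U [UU Uoo]] := ultraFilterLemma eventually_filter.
pose S M := [fset (h * y M)%g | h in H M]%fset.
have S0 M : S M != fset0.
  by apply/fset0Pn; exists (1 * y M)%g; apply: in_imfset; have [] := Hgrp M.
pose c := kappa * delta ^+ 2.
have c0 : 0 <= c by rewrite mulr_ge0// sqr_ge0.
have f1 k x : return_density k x <= 1.
  rewrite ler_pdivrMr// mul1r ler_nat; apply/fsubset_leq_card/fsubsetP => b.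
  by rewrite !inE => /andP[].
have flarge (e : R) : 0 < e -> forall m, exists2 k, (m <= k)%N &
    U [set M | c - e <= average S M (return_density k)].
  move=> e0 m; have [k0 k0P] := Hsq e0; exists (maxn m k0); first exact: leq_maxl.
  apply: Uoo; exists (maxn m k0) => // M /= kM.
  rewrite average_return_density//.
  apply: (le_trans _ (k0P _ (leq_maxr _ _) _ _ _ _)); last 2 first.
  - by move=> g _; exact: coset_correlation_bounds.
  - move=> s sH; apply: mean_positive_coset_correlation.
    by move=> g /sH; exact: H_mono.
  by rewrite lerD2r ler_wpM2l// lerXn2r ?nnegrE// (le_trans _ (yP M)).
have [K /choice[x xP]] := finitary_Fatou S0 UU c0 f1 flarge.
(* The ultralimit of the sets A x_i^-1, hence a set each finite part of which
   is a part of one of them. *)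
pose A' : set G := [set g | U [set i | (g * x i)%g \in A]].
pose B : set G := [set g | A' g /\ A' g^-1%g].
have agree g : U [set i | ((g * x i)%g \in A) = (g \in A')].
  case: (in_ultra_setVsetC [set i | (g * x i)%g \in A] UU) => HU.
    by rewrite (mem_set (HU : A' g)); exact: HU.
  have nA' : ~ A' g.
    by move=> /(filterI HU) /filter_ex[i []].
  by rewrite (memNset nA'); apply: filterS HU => i /= /negP/negbTE.
exists B; split; last first.
  move=> _ [b [bA _]] [b' [_ b'A]] <-.
  have /filter_ex[i [/= /set_mem bi /set_mem b'i]] :
    U ([set i | (b * x i)%g \in A] `&` [set i | (b'^-1 * x i)%g \in A]).
    exact: filterI.
  exists (b * x i)%g => //; exists (b'^-1 * x i)%g => //.
  by rewrite invgM invgK mulgA mulgK.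
rewrite -EFin_expe -EFinM mulrC; apply: le_limn_esup => e e0 m.
pose j := maxn m (Num.truncn e^-1).
have je : j.+1%:R^-1 <= e.
  rewrite -[leRHS]invrK lef_pV2 ?posrE ?invr_gt0 ?ltr0n// ltW//.
  by apply: lt_le_trans (truncnS_gt _) _; rewrite ler_nat ltnS leq_maxr.
(* One i such that A x_i^-1 agrees with A' on all the groups H k of the j-th
   window at once, as they are contained in H (K j). *)
have /filter_ex[i [ij iA]] : U ([set i | (j <= i)%N] `&`
    [set i | forall g : H (K j), ((fsval g * x i)%g \in A) = (fsval g \in A')]).
  apply: filterI; first by apply: Uoo; exists j.
  by apply: filter_forall => g; exact: agree.
have [k [jk kK ck]] := xP i j ij.
exists k; first by apply: leq_trans jk; exact: leq_maxl.
rewrite lee_fin; apply: le_trans (le_trans ck _); first by rewrite lerB.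
rewrite le_eqVlt; apply/orP; left; apply/eqP; congr (_%:R / _).
have [_ _ HV] := Hgrp k; have kKj := H_mono (ltnW kK).
congr #|` _|; apply/fsetP => b; rewrite !inE; apply: andb_id2l => bk.
rewrite (iA (FSetSub (kKj _ bk))) (iA (FSetSub (kKj _ (HV _ bk)))) /=.
apply/andP/idP => [[/set_mem ? /set_mem ?]|/set_mem[? ?]].
  exact: mem_set.
by split; apply: mem_set.
Qed.

End Intersectivity.
End LocallyFiniteGroup.

(** * The general linear group *)

Lemma GLfset_mono (Q : fieldType) n (K L : {fset Q}) :
  {subset K <= L} -> {subset GLfset n K <= GLfset n L}.
Proof. by move=> KL g /in_GLfset gK; apply/in_GLfset => i j; exact: KL. Qed.

Lemma square_recurrent_GLfset (R : realType) (Q : fieldType) (n : nat)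
    (K : nat -> {fset Q}) : (forall k, fset_subring (K k)) ->
  (forall m, exists k0, forall k, (k0 <= k)%N -> (m <= #|` K k|)%N) ->
  square_recurrent (fun k => GLfset n (K k)) (n`!%:R^-1 : R).
Proof.
move=> Kring Kinf e e0.
have [k0 k0P] := Kinf (Num.truncn ((n ^ 2)%:R / e)).+3.
exists k0 => k /k0P qk phi m phi01 phim.
have q1 : (1 < #|` K k|)%N by apply: leq_trans qk.
have [H1 _ _] := GLfset_subgroup n (Kring k).
have H0 : 0 < #|` GLfset n (K k)|%:R :> R.
  by rewrite ltr0n cardfs_gt0; apply/fset0Pn; exists 1%g.
have nf1 : 1 <= n`!%:R :> R by rewrite ler1n fact_gt0.
have nf0 : 0 < n`!%:R :> R by rewrite ltr0n fact_gt0.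
set E := (n ^ 2)%:R / (#|` K k|.-1)%:R : R.
have E_ge0 : 0 <= E by rewrite divr_ge0 ?ler0n.
have Ee : E <= e.
  have q0 : 0 < (#|` K k|.-1)%:R :> R by rewrite ltr0n -subn1 subn_gt0.
  rewrite ler_pdivrMr// mulrC -ler_pdivrMr//; apply/ltW.
  apply: lt_le_trans (truncnS_gt _) _; rewrite ler_nat.
  by rewrite -ltnS prednK 1?ltnW// ltnW.
have := sum_squares_GLfset (Kring k) q1 phi01 phim.
rewrite -/E mulrC -ler_pdivlMr// -[leRHS]mulrA [leRHS]mulrC -ler_pdivrMr//.
apply: le_trans; rewrite mulrBl [leLHS]addrC [leRHS]addrC mulrC lerD2r lerN2.
by rewrite ler_pdivrMr//; apply: le_trans Ee _; rewrite ler_peMr// ltW.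
Qed.

Theorem theorem1p34 (R : realType) (Q : fieldType)
    (Q_countable : ([set: Q] #= [set: nat])%card)
    (p : nat) (charQ : p \in [pchar Q])
    (Q_algebraic : forall x : Q,
       algebraicOver (GRing.in_alg (pPrimeCharType charQ)) x)
    (n : nat) (n_gt0 : (0 < n)%N) :
  amenable R (GL Q n) /\
  exists F : nat -> {fset GL Q n},
    [/\ two_sided_Folner R F,
        forall (d : measure_display) (X : measurableType d)
               (mu : probability X R) (T : GL Q n -> X -> X) (Y : set X),
          measure_preserving_system mu T -> measurable Y ->
          (mu Y ^+ 2 * (n`!%:R^-1)%:E <=
           limn_esup (fun N =>
             (#|` F N|%:R^-1)%:E *
             \sum_(g <- F N) mu (Y `&` (T g \o T g) @` Y)))%E
      & forall A : set (GL Q n), exists B : set (GL Q n),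
          (upper_left_Banach_density R A ^+ 2 * (n`!%:R^-1)%:E <=
           upper_density R F B)%E /\
          [set (b * b')%g | b in B & b' in B] `<=`
          [set (a * a'^-1)%g | a in A & a' in A]].
Proof.
have Qinf : infinite_set [set: Q].
  by move=> Qfin; apply: infinite_nat; rewrite -(eq_finite_set Q_countable).
pose H k := GLfset n (Frobenius_fixed Q p k).
have Hgrp k : fset_subgroup (H k) := GLfset_subgroup n (Frobenius_fixed_subring charQ k).
have Hmono k l : (k <= l)%N -> {subset H k <= H l}.
  by move=> kl; apply: GLfset_mono; exact: Frobenius_fixed_mono.
have Hex g : exists k, g \in H k.
  have [k kP] := Frobenius_fixed_absorb Q_algebraic
    [fset GLmx g ij.1 ij.2 | ij in {: 'I_n * 'I_n}]%fset.
  exists k; apply/in_GLfset => i j; apply: (kP k) => //.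
  by apply/imfsetP; exists (i, j).
have Hsq : square_recurrent H (n`!%:R^-1 : R).
  apply: square_recurrent_GLfset; first exact: Frobenius_fixed_subring.
  exact: card_Frobenius_fixed.
have kappa0 : 0 <= n`!%:R^-1 :> R by rewrite invr_ge0 ler0n.
have HF : two_sided_Folner R H by exact: two_sided_Folner_subgroups.
split; first by exists H; case: HF.
exists H; split=> // [d X mu T Y Tsys mY|A].
  exact: square_recurrence.
exact: square_intersectivity.
Qed.
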